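(* Let $q$ be a power of a prime number. Then the following two statements are equivalent: (i) $q+1$ is either of the form $q+1=2^t$, $q+1=\pi$, or $q+1=2\pi$, for some positive integer $t$ and some prime $\pi>2$; (ii) every irreducible polynomial of the form $f(x)=x^2+bx+c\in\mathbb{F}_q[x]$, with $b\neq 0$ and $c$ a primitive element of $\mathbb{F}_q$, is a primitive polynomial over $\mathbb{F}_q$.
   Context: $\mathbb{F}_q$ denotes the finite field with $q$ elements. A primitive element of $\mathbb{F}_q$ is a generator of the cyclic group $\mathbb{F}_q^*$. A polynomial $f(x)\in\mathbb{F}_q[x]$ of degree $m\ge 1$ is called a primitive polynomial over $\mathbb{F}_q$ if it is the (monic) minimal polynomial over $\mathbb{F}_q$ of a primitive element of $\mathbb{F}_{q^m}$. *)

(* Defs.v *)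
From HB Require Import structures.
From mathcomp Require Import all_boot all_order all_fingroup all_algebra.
From mathcomp Require Import all_solvable all_field.

Set Implicit Arguments.
Unset Strict Implicit.
Unset Printing Implicit Defensive.

Import GRing.Theory.
Local Open Scope ring_scope.

Definition primitive_element (K : finFieldType) (a : K) : Prop :=
  exists2 u : {unit K}, FinRing.uval u = a & generator [set: {unit K}] u.

(* An extension [L] of [F] of dimension [m] is a copy of the field with
   [#|F| ^ m] elements; [finvect_type L] is [L] itself, seen as a finite field.
   This is not [qfpoly.primitive_poly], which is phrased through the order of
   ['X] modulo [f] instead of minimal polynomials. *)
Definition is_primitive_poly (F : finFieldType) (f : {poly F}) : Prop :=
  exists m : nat, [/\ (1 <= m)%N, size f = m.+1 &
    exists (L : fieldExtType F) (a : L),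
      [/\ \dim {:L} = m,
          primitive_element (a : finvect_type L)
        & minPoly 1 a = map_poly (in_alg L) f]].

(* Main.v *)
Require Import Defs.
From HB Require Import structures.
From mathcomp Require Import all_boot all_order all_fingroup all_algebra.
From mathcomp Require Import all_solvable all_field.
From mathcomp Require Import zify ring.

(** A root [a] of an irreducible [x^2 + b x + c] in the quadratic extension
    satisfies [a ^ (q + 1) = c] and [a ^ q + a = - b].  If [c] is primitive, a
    prime [r] with [a ^ ((q^2 - 1) / r) = 1] divides [q + 1] but not [q - 1].
    Under (i) this forces [(q + 1) / r] to divide 2, so [a ^ (2 (q - 1)) = 1],
    that is [a ^ q = a] or [a ^ q = - a]; the first contradicts irreducibility
    and the second contradicts [b <> 0].  Conversely, if (i) fails then [q + 1]
    has an odd prime factor [r] with [q + 1] not dividing [2 r]; for [g] a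
    primitive element of the quadratic extension, [g ^ r] is a root of a
    quadratic violating (ii). *)

Set Implicit Arguments.
Unset Strict Implicit.
Unset Printing Implicit Defensive.

Import GRing.Theory.
Local Open Scope ring_scope.

(** * Roots of unity and primitive elements *)

Lemma prime_quotients_prim_root (R : nzRingType) (n : nat) (z : R) :
  (0 < n)%N -> z ^+ n = 1 ->
  (forall r, prime r -> (r %| n)%N -> z ^+ (n %/ r) != 1) ->
  n.-primitive_root z.
Proof.
move=> n_gt0 zn1 hr; have [m zm m_dvd_n] := prim_order_exists n_gt0 zn1.
have [/eqP nm1 | nm_neq1] := boolP (n %/ m == 1)%N.
  by rewrite -(divnK m_dvd_n) nm1 mul1n.
(* If the order [m] of [z] were a proper divisor of [n], a prime [r] dividing [n %/ m] would make
   [m] divide [n %/ r], so [z ^+ (n %/ r)] would be 1. *)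
have r_pr : prime (pdiv (n %/ m)).
  apply: pdiv_prime; rewrite ltn_neqAle eq_sym nm_neq1 /=.
  by rewrite divn_gt0 ?(prim_order_gt0 zm) //; exact: dvdn_leq.
have /dvdnP[k nmE] := pdiv_dvd (n %/ m).
set r := pdiv _ in r_pr nmE.
have nE : n = (k * m * r)%N by rewrite -(divnK m_dvd_n) nmE; lia.
have := hr r r_pr; rewrite {1}nE dvdn_mull // => /(_ isT).
by rewrite nE mulnK ?prime_gt0 // -(prim_order_dvd zm) dvdn_mull.
Qed.

(** Replaces generators of the unit group by multiplicative orders, which can be computed directly
    in the field. *)
Lemma primitive_elementE (K : finFieldType) (a : K) :
  primitive_element a <-> (#|K|.-1).-primitive_root a.
Proof.
have cardU : #|[set: {unit K}]| = #|K|.-1 by exact: card_finField_unit.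
have unitX (u : {unit K}) i : (FinRing.uval u ^+ i == 1) = (#[u]%g %| i)%N.
  by rewrite order_dvdn -val_eqE /= FinRing.val_unitX.
have n_gt0 : (0 < #|K|.-1)%N by rewrite -cardU cardG_gt0.
split=> [[u <- /eqP gen_u] | a_prim].
  have u_ord : #[u]%g = #|K|.-1 by rewrite -cardU gen_u.
  apply: prime_quotients_prim_root => //.
    by apply/eqP; rewrite unitX u_ord.
  move=> r r_pr r_dvd; rewrite unitX u_ord gtnNdvd //.
    by rewrite divn_gt0 ?prime_gt0 //; exact: dvdn_leq.
  by apply: ltn_Pdiv; first exact: prime_gt1.
have a_unit : a \is a GRing.unit.
  by rewrite unitfE (prim_root_eq0 a_prim) -lt0n.
exists (FinRing.unit K a_unit) => //.
rewrite /generator eq_sym eqEcard subsetT /= cardU -orderE.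
apply: dvdn_leq; first exact: order_gt0.
by rewrite (prim_order_dvd a_prim) (unitX (FinRing.unit K a_unit)).
Qed.

Lemma finField_prim_root (K : finFieldType) :
  exists g : K, (#|K|.-1).-primitive_root g.
Proof.
have /cyclicP[u gen_u] := field_unit_group_cyclic [set: {unit K}].
exists (FinRing.uval u); apply/primitive_elementE.
by exists u => //; rewrite /generator gen_u.
Qed.

Lemma finField_irreducible_quadratic (F : finFieldType) :
  exists c : F, irreducible_poly ('X^2 - 'X - c%:P).
Proof.
(* [x ^+ 2 - x] takes the same value at 0 and 1, so it misses some [c]. *)
have /forallPn[c /existsPn c_img] :
    ~~ [forall c : F, exists x : F, x ^+ 2 - x == c].
  apply/negP => /forallP sq_onto.
  (* A section [s] of a surjection is injective, hence bijective on the finite [F]; the surjection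
     is then injective as well. *)
  have [s sK] : exists s : F -> F, cancel s (fun x => x ^+ 2 - x).
    exists (fun c => xchoose (existsP (sq_onto c))) => c.
    exact/eqP/(xchooseP (existsP (sq_onto c))).
  have [t _ tK] := injF_bij (can_inj sK).
  have s_sq x : s (x ^+ 2 - x) = x.
    by rewrite -[in RHS](tK x) -[in LHS](tK x) sK.
  have /eqP : s (1 ^+ 2 - 1) = s (0 ^+ 2 - 0) by congr s; ring.
  by rewrite !s_sq oner_eq0.
exists c; apply: cubic_irreducible => [|x].
  by rewrite -addrA size_polyDl size_polyXn // -opprD size_polyN size_XaddC.
by rewrite rootE !hornerE subr_eq0 c_img.
Qed.

(** * Frobenius, conjugates and minimal polynomials in a finite extension *)

Section FiniteExtension.

Variables (F : finFieldType) (L : fieldExtType F).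

Lemma card_finvect : #|finvect_type L| = (#|F| ^ \dim {:L})%N.
Proof. by rewrite -(card_vspace {:finvect_type L}) card_vspacef. Qed.

Lemma expf_card_finvect (x : L) : x ^+ (#|F| ^ \dim {:L}) = x.
Proof. by rewrite -card_finvect; exact: (@expf_card (finvect_type L)). Qed.

(** [#|F|] is a power of the characteristic, which [L] shares with [F]. *)
Lemma exprD_card (x y : L) : (x + y) ^+ #|F| = x ^+ #|F| + y ^+ #|F|.
Proof.
have [p p_pr pF] := finPcharP F; apply: exprDn_pchar.
have [n nE] : exists n, #|F| = (p ^ n)%N.
  by exists (logn p #|F|); exact: (card_pprimeChar pF).
rewrite (eq_pnat _ (pcharf_eq (_ : p \in [pchar L]))) ?pchar_lalg // nE.
by rewrite pnatX pnat_id.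
Qed.

(** The polynomial [X^q - X] is the product of all [X - k] with [k] in [F], so it has no further
    root in [L]. *)
Lemma expr_card_id (x : L) : x ^+ #|F| = x <-> exists k : F, x = k%:A.
Proof.
split=> [xq | [k ->]]; last by rewrite -(rmorphXn (in_alg L)) expf_card.
have /(congr1 (fun p => (map_poly (in_alg L) p).[x])) := finField_genPoly F.
rewrite rmorphB /= map_polyXn map_polyX !hornerE xq subrr.
rewrite rmorph_prod /= horner_prod => /esym/eqP; rewrite prodf_seq_eq0.
case/hasP=> k _ /=; rewrite rmorphB /= map_polyX map_polyC !hornerE subr_eq0.
by move=> /eqP ->; exists k.
Qed.

Lemma in_alg_quadratic (b c : F) :
  map_poly (in_alg L) ('X^2 + b *: 'X + c%:P) = 'X^2 + b%:A *: 'X + (c%:A)%:P.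
Proof.
by rewrite !rmorphD /= map_polyXn map_polyZ map_polyX map_polyC.
Qed.

(** Frobenius fixes the coefficients, so [a ^+ #|F|] is a second root, distinct from [a]; the
    conclusion is Vieta's formulas. *)
Lemma quadratic_conjugates (b c : F) (a : L) :
    root (map_poly (in_alg L) ('X^2 + b *: 'X + c%:P)) a ->
    a ^+ #|F| != a ->
  a ^+ #|F| + a = - b%:A /\ a ^+ #|F|.+1 = c%:A.
Proof.
rewrite in_alg_quadratic rootE !hornerE => /eqP fa aq.
have faq : a ^+ #|F| ^+ 2 + b%:A * a ^+ #|F| + c%:A = 0.
  have k_fix k : k%:A ^+ #|F| = k%:A :> L by apply/expr_card_id; exists k.
  rewrite -[in X in _ + X = _]k_fix -[b%:A]k_fix -exprMn exprAC -!exprD_card.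
  by rewrite fa expr0n gtn_eqF //; apply/card_gt0P; exists 0.
have sumE : a ^+ #|F| + a = - b%:A.
  apply/eqP; rewrite -subr_eq0 opprK.
  (* Subtracting the equations of the two roots leaves a multiple of their difference. *)
  have /eqP : (a ^+ #|F| - a) * (a ^+ #|F| + a + b%:A) = 0.
    by rewrite -[RHS](subrr 0) -{1}faq -fa; ring.
  by rewrite mulf_eq0 subr_eq0 (negPf aq).
split=> //; rewrite exprSr -(addrK a (a ^+ _)) sumE.
by apply/esym/eqP; rewrite -subr_eq0 -fa; apply/eqP; ring.
Qed.

(** The minimal polynomial has coefficients in [F], is not constant and divides [p]; both are monic,
    so irreducibility forces equality. *)
Lemma minPoly_irreducible (p : {poly F}) (a : L) :
    irreducible_poly p -> p \is monic -> root (map_poly (in_alg L) p) a ->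
  minPoly 1 a = map_poly (in_alg L) p.
Proof.
move=> [_ p_irr] p_monic pa0.
have /polyOver1P[m mE] := minPolyOver 1 a.
have m_monic : m \is monic by rewrite -(map_monic (in_alg L)) -mE monic_minPoly.
have m_dvd_p : m %| p.
  rewrite -(dvdp_map (in_alg L)) -mE minPoly_dvdp //.
  by apply/polyOver1P; exists p.
have size_m : size m != 1%N.
  by rewrite -(size_map_poly (in_alg L)) -mE size_minPoly.
have := p_irr m size_m m_dvd_p; rewrite eqp_monic // => /eqP <-.
exact: mE.
Qed.

End FiniteExtension.

(** If [p] did not divide [s] they would be coprime, with no common root. This carries an equation
    such as [a ^+ k = 1] to a root of [p] in an unrelated extension. *)
Lemma irreducible_root_transfer (F : fieldType) (L L' : fieldExtType F)
    (p s : {poly F}) (a : L) (a' : L') :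
    irreducible_poly p ->
    root (map_poly (in_alg L) p) a -> root (map_poly (in_alg L') p) a' ->
  root (map_poly (in_alg L) s) a -> root (map_poly (in_alg L') s) a'.
Proof.
move=> p_irr pa pa' sa; have p_dvd_s : p %| s.
  apply: contraLR sa; rewrite -irreducible_poly_coprime // => p_s.
  by apply: coprimep_root pa; rewrite coprimep_map.
by apply: root_dvdp pa'; rewrite dvdp_map.
Qed.

Lemma two_power_or_odd_prime_factor (m : nat) : (0 < m)%N ->
  (exists t, m = 2 ^ t)%N \/ exists r, [/\ prime r, odd r & r %| m]%N.
Proof.
move=> m_gt0; have [/p_natP[t ->] | ] := boolP (2.-nat m)%N.
  by left; exists t.
rewrite /pnat m_gt0 /= => /allPn[r]; rewrite mem_primes => /and3P[r_pr _ r_dvd].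
rewrite inE /= => r_neq2; right; exists r; split=> //.
by case: (even_prime r_pr) r_neq2 => [->|].
Qed.

Section Quadratic.

Variables (F : finFieldType) (b c : F).

Lemma quadratic_polyE : 'X^2 + b *: 'X + c%:P = 'X^2 + (b *: 'X + c%:P).
Proof. by rewrite addrA. Qed.

Lemma size_quadratic_tail : (size (b *: 'X + c%:P)%R <= 2)%N.
Proof.
rewrite (leq_trans (size_polyD _ _)) // geq_max size_polyC.
by rewrite (leq_trans (size_scale_leq _ _)) ?size_polyX //; case: (c != 0).
Qed.

Lemma size_quadratic : size ('X^2 + b *: 'X + c%:P) = 3.
Proof.
by rewrite quadratic_polyE size_polyDl size_polyXn // ltnS size_quadratic_tail.
Qed.

Lemma monic_quadratic : 'X^2 + b *: 'X + c%:P \is monic.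
Proof.
rewrite quadratic_polyE monicE lead_coefDl ?lead_coefXn //.
by rewrite size_polyXn ltnS size_quadratic_tail.
Qed.

End Quadratic.

(** * Orders of roots of quadratics and the arithmetic of [q + 1] *)

Lemma pred_expn2 (q : nat) : ((q ^ 2).-1 = q.-1 * q.+1)%N.
Proof. by case: q => // q; rewrite /=; nia. Qed.

Lemma quadratic_root_primitive (F : finFieldType) (L : fieldExtType F)
    (b c : F) (a : L) :
    \dim {:L} = 2%N -> b != 0 -> (#|F|.-1).-primitive_root c ->
    root (map_poly (in_alg L) ('X^2 + b *: 'X + c%:P)) a -> a ^+ #|F| != a ->
    (forall r, prime r -> r %| #|F|.+1 -> ~~ (r %| #|F|.-1) ->
       #|F|.+1 %| r * 2)%N ->
  ((#|F| ^ 2).-1).-primitive_root a.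
Proof.
move=> dimL b_neq0 c_prim fa aq hr.
have [sumE prodE] := quadratic_conjugates fa aq.
have q_gt1 : (1 < #|F|)%N by exact: finNzRing_gt1.
have a_neq0 : a != 0.
  by apply: contraNneq aq => ->; rewrite expr0n gtn_eqF // ltnW.
(* Otherwise [a ^+ #|F|] is [a] or [- a]; the latter makes the trace [- b] vanish. *)
have sq_neq1 : a ^+ (#|F|.-1 * 2) != 1.
  apply/negP; rewrite exprM sqrf_eq1.
  have aqE : a ^+ #|F| = a ^+ #|F|.-1 * a by rewrite -exprSr prednK // ltnW.
  case/orP=> /eqP e; rewrite e in aqE; first by rewrite aqE mul1r eqxx in aq.
  move: sumE; rewrite aqE mulN1r addNr => /eqP.
  by rewrite eq_sym oppr_eq0 scaler_eq0 oner_eq0 orbF (negPf b_neq0).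
have N_gt0 : (0 < (#|F| ^ 2).-1)%N by rewrite pred_expn2; nia.
apply: prime_quotients_prim_root => // [|r r_pr].
  apply: (mulIf a_neq0); rewrite mul1r -exprSr prednK; last by nia.
  by rewrite -dimL expf_card_finvect.
(* For [r] dividing [q - 1], the power of [a] is the norm [c] raised to [(q - 1) / r], which is not
   1 because [c] has order [q - 1]. *)
rewrite pred_expn2; have [r_dvd _ | r_ndvd] := boolP (r %| #|F|.-1)%N.
  rewrite -divn_mulAC // mulnC exprM prodE -(rmorphXn (in_alg L)) fmorph_eq1.
  rewrite -(prim_order_dvd c_prim) gtnNdvd //; last first.
    by apply: ltn_Pdiv; [exact: prime_gt1 | lia].
  by rewrite divn_gt0 ?prime_gt0 //; apply: dvdn_leq => //; lia.
rewrite Euclid_dvdM // (negPf r_ndvd) /= => r_dvd.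
(* Here [(q + 1) / r] divides 2, so [a ^ ((q - 1) (q + 1) / r) = 1] would give
   [a ^ (2 (q - 1)) = 1]. *)
apply: contraNneq sq_neq1; rewrite -muln_divA // => a1.
have /dvdnP[m ->] : (#|F|.+1 %/ r %| 2)%N.
  by rewrite dvdn_divLR ?prime_gt0 // mulnC hr.
by rewrite mulnCA mulnC exprM a1 expr1n.
Qed.

Lemma succ_dvd_double (q r : nat) : (1 < q)%N ->
    (exists2 t : nat, (0 < t)%N & (q + 1 = 2 ^ t)%N) \/
    (exists pi : nat, [/\ prime pi, (2 < pi)%N & (q + 1 = pi)%N]) \/
    (exists pi : nat, [/\ prime pi, (2 < pi)%N & (q + 1 = 2 * pi)%N]) ->
  prime r -> (r %| q.+1)%N -> ~~ (r %| q.-1)%N -> (q.+1 %| r * 2)%N.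
Proof.
rewrite addn1 => q_gt1.
(* The premises are contradictory, as [q - 1] and [q + 1] have the same parity. This disposes of
   [r = 2], where [2 * 2] is [r * 2]. *)
have two_ndvd : ~~ odd q.+1 -> ~~ (2 %| q.-1)%N -> (q.+1 %| 2 * 2)%N.
  by rewrite dvdn2; lia.
case=> [[t t_gt0 qE] | [[pi [pi_pr _ qE]] | [pi [pi_pr pi_gt2 qE]]]] r_pr.
- rewrite {1}qE Euclid_dvdX // dvdn_prime2 // => /andP[/eqP -> _].
  by apply: two_ndvd; rewrite qE oddX; lia.
- by rewrite qE dvdn_prime2 // => /eqP -> _; apply: dvdn_mulr.
rewrite {1}qE Euclid_dvdM // (dvdn_prime2 r_pr) // (dvdn_prime2 r_pr pi_pr).
case/orP=> /eqP ->.
  by apply: two_ndvd; rewrite qE oddM.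
by rewrite qE mulnC.
Qed.

(** Unless [q + 1] is a power of 2 it is [k * r] for an odd prime [r]; if it also divides [r * 2],
    then [k] is 1 or 2. *)
Lemma succ_special_or_odd_prime_factor (q : nat) : (1 < q)%N ->
    ((exists2 t : nat, (0 < t)%N & (q + 1 = 2 ^ t)%N) \/
    (exists pi : nat, [/\ prime pi, (2 < pi)%N & (q + 1 = pi)%N]) \/
    (exists pi : nat, [/\ prime pi, (2 < pi)%N & (q + 1 = 2 * pi)%N])) \/
  exists r, [/\ prime r, odd r, r %| q.+1 & ~~ (q.+1 %| r * 2)]%N.
Proof.
move=> q_gt1; rewrite addn1.
have [[t qE] | [r [r_pr r_odd r_dvd]]] :=
  two_power_or_odd_prime_factor (ltn0Sn q).
  by left; left; exists t => //; case: t qE => //; lia.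
have r_gt2 := odd_prime_gt2 r_odd r_pr.
have [q_dvd | ] := boolP (q.+1 %| r * 2)%N; last by right; exists r.
left; right; have /dvdnP[k qE] := r_dvd.
move: q_dvd; rewrite qE mulnC dvdn_pmul2l ?prime_gt0 //.
case: k qE => [|[|[|k]]] // qE _.
  by left; exists r; rewrite muln1.
by right; exists r; rewrite mulnC.
Qed.

Lemma exists_nonprimitive_quadratic (F : finFieldType) (L : fieldExtType F)
    (r : nat) :
    \dim {:L} = 2%N -> prime r -> odd r -> (r %| #|F|.+1)%N ->
    ~~ (#|F|.+1 %| r * 2)%N ->
  exists b c : F, exists a : L,
    [/\ b != 0, (#|F|.-1).-primitive_root c,
        irreducible_poly ('X^2 + b *: 'X + c%:P),
        root (map_poly (in_alg L) ('X^2 + b *: 'X + c%:P)) a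
      & a ^+ ((#|F| ^ 2).-1 %/ r) = 1].
Proof.
move=> dimL r_pr r_odd r_dvd q_ndvd.
have q_gt1 : (1 < #|F|)%N by exact: finNzRing_gt1.
have [g] := finField_prim_root (finvect_type L).
rewrite card_finvect dimL => g_prim; pose a : L := g ^+ r.
(* A common divisor of [q - 1] and [q + 1] divides 2, whereas [r] is odd. *)
have r_coprime : coprime r #|F|.-1.
  rewrite prime_coprime //; apply/negP => r_dvd'.
  have qE : #|F|.+1 = (#|F|.-1 + 2)%N by lia.
  move: r_dvd; rewrite qE dvdn_addr // => /dvdn_leq => /(_ isT).
  by rewrite leqNgt odd_prime_gt2.
have aqq : a ^+ #|F| ^+ #|F| = a.
  by rewrite -exprM -[(_ * _)%N]/(#|F| ^ 2)%N -dimL expf_card_finvect.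
(* Norm and trace of [a] are fixed by Frobenius, so they lie in [F]. *)
have [c cE] : exists c : F, a ^+ #|F|.+1 = c%:A.
  by apply/expr_card_id; rewrite exprS exprMn aqq mulrC -exprS.
have [b bE] : exists b : F, - (a ^+ #|F| + a) = b%:A.
  apply/expr_card_id; rewrite -mulN1r exprMn exprD_card aqq addrC.
  (* [(-1) ^ q = -1] because [-1] lies in [F], which covers even [q] too. *)
  by congr (_ * _); apply/expr_card_id; exists (-1); rewrite scaleN1r.
have a_prim : ((#|F| ^ 2).-1 %/ r).-primitive_root a.
  have := exp_prim_root g_prim r; rewrite (gcdn_idPl _) //.
  by rewrite pred_expn2 dvdn_mull.
(* This excludes [a ^ q = a] and [a ^ q = - a] at once: the first is needed for irreducibility, the
   second for [b != 0]. *)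
have sq_neq1 : a ^+ (#|F|.-1 * 2) != 1.
  rewrite -(prim_order_dvd a_prim) pred_expn2 -muln_divA //.
  rewrite dvdn_pmul2l; last lia.
  by rewrite dvdn_divLR ?prime_gt0 // mulnC.
have aqE : a ^+ #|F| = a ^+ #|F|.-1 * a by rewrite -exprSr prednK // ltnW.
have a_neq0 : a != 0.
  by rewrite (prim_root_eq0 a_prim) -lt0n (prim_order_gt0 a_prim).
have aq_neq : a ^+ #|F| != a.
  apply: contraNneq sq_neq1; rewrite aqE -[X in _ = X -> _]mul1r.
  by move/(mulIf a_neq0) => e; rewrite exprM e expr1n.
have fE : map_poly (in_alg L) ('X^2 + b *: 'X + c%:P)
          = ('X - a%:P) * ('X - (a ^+ #|F|)%:P).
  rewrite in_alg_quadratic -bE -cE (exprSr a) -mul_polyC polyCN polyCD polyCM.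
  by ring.
exists b, c, a; split.
- apply: contraNneq sq_neq1 => b0; move: bE; rewrite b0 scale0r aqE => /eqP.
  rewrite oppr_eq0 -[X in _ + X]mul1r -mulrDl mulf_eq0 (negPf a_neq0) orbF.
  by rewrite addr_eq0 => /eqP e; rewrite exprM e sqrrN expr1n.
(* [c] is [g ^ (r (q + 1))], of order [(q^2 - 1) / gcd(r (q + 1), q^2 - 1)]; the gcd is [q + 1]
   since [r] is coprime to [q - 1]. *)
- rewrite -(fmorph_primitive_root (in_alg L)) /= -cE -exprM.
  have := exp_prim_root g_prim (r * #|F|.+1).
  by rewrite pred_expn2 -muln_gcdl (eqP r_coprime) mul1n mulnK.
- apply: cubic_irreducible => [|x]; first by rewrite size_quadratic.
  rewrite -(fmorph_root (in_alg L)) fE rootM !root_XsubC /=.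
  (* A root in [F] would be [a] or [a ^ q]; as [a ^ (q^2) = a], either case gives [a ^ q = a]. *)
  apply: contra aq_neq => /orP[] /eqP e.
    by apply/eqP/expr_card_id; exists x.
  by rewrite -{2}aqq; apply/eqP/esym/expr_card_id; exists x.
- by rewrite fE rootM root_XsubC eqxx.
by rewrite (prim_expr_order a_prim).
Qed.

Theorem theorem6 (p n q : nat) (hp : prime p) (hn : (0 < n)%N)
    (hq : q = (p ^ n)%N) (F : finFieldType) (hF : #|F| = q) :
  ((exists2 t : nat, (0 < t)%N & (q + 1 = 2 ^ t)%N) \/
   (exists pi : nat, [/\ prime pi, (2 < pi)%N & (q + 1 = pi)%N]) \/
   (exists pi : nat, [/\ prime pi, (2 < pi)%N & (q + 1 = 2 * pi)%N]))
  <->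
  (forall b c : F, b != 0 -> primitive_element c ->
     irreducible_poly ('X^2 + b *: 'X + c%:P) ->
     is_primitive_poly ('X^2 + b *: 'X + c%:P)).
Proof.
have q_gt1 : (1 < q)%N by rewrite -hF; exact: finNzRing_gt1.
split=> [hcond b c b_neq0 /primitive_elementE c_prim f_irr | f_prim].
  have [L dimL [a fa _]] := irredp_FAdjoin f_irr.
  rewrite size_quadratic /= in dimL.
  exists 2%N; split=> //; first exact: size_quadratic.
  exists L, a; split=> //; last first.
    exact: minPoly_irreducible (monic_quadratic b c) fa.
  apply/primitive_elementE; rewrite card_finvect dimL.
  apply: (quadratic_root_primitive dimL b_neq0 c_prim fa) => [|r]; last first.
    by rewrite hF; exact: succ_dvd_double.
  (* If [a ^ q = a], then [a] comes from some [x] in [F], and ['X - x%:P] is a proper factor of the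
     irreducible quadratic. *)
  apply/eqP => /expr_card_id[x xE]; case: f_irr => _ f_irr.
  have := f_irr ('X - x%:P); rewrite size_XsubC => /(_ isT).
  rewrite dvdp_XsubCl -(fmorph_root (in_alg L)) /= -xE => /(_ fa).
  by move/eqp_size; rewrite size_XsubC size_quadratic.
case: (succ_special_or_odd_prime_factor q_gt1) => // -[r [r_pr r_odd]].
rewrite -hF => r_dvd q_ndvd.
(* Any irreducible quadratic will do here: it only serves to build an extension of dimension 2. *)
have [d d_irr] := finField_irreducible_quadratic F.
have [L dimL _] := irredp_FAdjoin d_irr.
have {}dimL : \dim {:L} = 2%N.
  rewrite dimL -addrA size_polyDl size_polyXn //.
  by rewrite -opprD size_polyN size_XaddC.
have [b [c [a [b_neq0 c_prim f_irr fa a1]]]] :=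
  exists_nonprimitive_quadratic dimL r_pr r_odd r_dvd q_ndvd.
have /primitive_elementE c_prim_elt := c_prim.
have [m [_ size_f [L' [a' [dimL' /primitive_elementE a'_prim a'E]]]]] :=
  f_prim b c b_neq0 c_prim_elt f_irr.
move: size_f; rewrite size_quadratic => -[mE].
rewrite card_finvect dimL' -mE in a'_prim.
have fa' : root (map_poly (in_alg L') ('X^2 + b *: 'X + c%:P)) a'.
  by rewrite -a'E root_minPoly.
have XnE (K : fieldExtType F) (x : K) k :
    root (map_poly (in_alg K) ('X^k - 1)) x = (x ^+ k == 1).
  by rewrite rmorphB /= map_polyXn rmorph1 rootE !hornerE subr_eq0.
(* The primitive root [a'] lives in its own extension [L']. Transferring [a ^ ((q^2 - 1) / r) = 1]
   to it makes its order [q^2 - 1] divide a smaller positive number. *)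
have := irreducible_root_transfer f_irr fa fa'
  (s := 'X^((#|F| ^ 2).-1 %/ r) - 1).
rewrite !XnE a1 eqxx => /(_ isT); rewrite -(prim_order_dvd a'_prim).
have N_gt0 : (0 < (#|F| ^ 2).-1)%N by rewrite pred_expn2 hF; nia.
rewrite gtnNdvd //; last by apply: ltn_Pdiv => //; exact: prime_gt1.
rewrite divn_gt0 ?prime_gt0 //; apply: dvdn_leq => //.
by rewrite pred_expn2 dvdn_mull.
Qed.
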